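(* Let $\mathbb{G}$ be a homogeneous Lie group with homogeneous dimension $Q$ and let $|\cdot|$ be a homogeneous quasi-norm on $\mathbb{G}$. Let $\alpha\in(0,\infty)$. Then for every $u\in L^{1,\alpha}(\mathbb{G})\setminus\{0\}$ we have $$\int_{\mathbb{G}}\frac{|u(x)|}{\|u\|_{L^{1}(\mathbb{G})}}\log\left(\left(\frac{|u(x)|}{\|u\|_{L^{1}(\mathbb{G})}}\right)^{-1}\right)dx\leq \frac{Q}{\alpha}\log\left(\frac{\alpha\, e\, A_{Q,\alpha}}{Q}\,\frac{\||\cdot|^{\alpha}u\|_{L^{1}(\mathbb{G})}}{\|u\|_{L^{1}(\mathbb{G})}}\right),$$ where $A_{Q,\alpha}>0$ is defined by $$A_{Q,\alpha}^{\frac{Q}{\alpha}}=\frac{|\mathfrak{S}|\,\Gamma\left(\frac{Q}{\alpha}\right)}{\alpha}.$$ Moreover, $A_{Q,\alpha}$ is the best possible constant (i.e. the inequality, required for all $u\in L^{1,\alpha}(\mathbb{G})\setminus\{0\}$, fails if $A_{Q,\alpha}$ is replaced by any smaller positive constant), and it is attained: equality holds in the inequality for $u=E_{\alpha}$, where $E_{\alpha}(x)=\exp(-A_{Q,\alpha}|x|^{\alpha})$.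
   Context: A homogeneous (Lie) group $\mathbb{G}$ is a Lie group on $\mathbb{R}^{N}$ (with identity $0$) equipped with dilations $D_{\lambda}(x)=(\lambda^{\nu_{1}}x_{1},\ldots,\lambda^{\nu_{N}}x_{N})$, $\nu_{1},\ldots,\nu_{N}>0$, which are automorphisms of $\mathbb{G}$ for each $\lambda>0$; one writes $\lambda x$ for $D_{\lambda}(x)$. Its homogeneous dimension is $Q=\nu_{1}+\cdots+\nu_{N}$. The Haar measure $dx$ on $\mathbb{G}$ is the Lebesgue measure on $\mathbb{R}^{N}$, and $L^{p}(\mathbb{G})$ is taken with respect to it. A homogeneous quasi-norm on $\mathbb{G}$ is a continuous function $\mathbb{G}\ni x\mapsto|x|\in[0,\infty)$ such that (a) $|x|=|x^{-1}|$ for all $x\in\mathbb{G}$; (b) $|\lambda x|=\lambda|x|$ for all $x\in\mathbb{G}$, $\lambda>0$; (c) $|x|=0$ if and only if $x=0$. The unit quasi-sphere is $\mathfrak{S}=\{x\in\mathbb{G}:|x|=1\}$. There is a unique Radon measure $\sigma$ on $\mathfrak{S}$ such that $\int_{\mathbb{G}}f(x)\,dx=\int_{0}^{\infty}\int_{\mathfrak{S}}f(ry)r^{Q-1}\,d\sigma(y)\,dr$ for all $f\in L^{1}(\mathbb{G})$, and $|\mathfrak{S}|=\sigma(\mathfrak{S})$ denotes the $(Q-1)$-dimensional surface measure of the unit quasi-sphere. The weighted space is $L^{p,\alpha}(\mathbb{G})=\{u: u\in L^{p}_{loc}(\mathbb{G}),\ \langle x\rangle^{\alpha}u\in L^{p}(\mathbb{G})\}$,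 $\alpha>0$, where $\langle x\rangle=(1+|x|^{2})^{1/2}$. $\Gamma$ is the Euler Gamma function. The usual convention $0\log(1/0)=0$ is used, and the integral on the left-hand side is understood as an extended real number (possibly $-\infty$). *)

(* Defs.v *)
From HB Require Import structures.
From mathcomp Require Import all_boot all_order all_algebra.
From mathcomp Require Import all_classical all_reals all_analysis.
From mathcomp Require Import lra.

Set Implicit Arguments.
Unset Strict Implicit.
Unset Printing Implicit Defensive.

Import Order.TTheory GRing.Theory Num.Theory.
Import numFieldNormedType.Exports.

Local Open Scope classical_set_scope.
Local Open Scope ring_scope.

Definition measure_rV_display : measure_display.
Proof. exact: default_measure_display. Qed.

(* The product sigma-algebra of R^n, generated by the coordinates, as the
   library does for n.-tuple T; it is the Borel one, see measurable_rVE. *)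
Section measurable_rV.
Variables (R : realType) (n : nat).

Let coord (i : 'I_n) (x : 'rV[R]_n) : R := x ord0 i.

Let rV_set0 : g_sigma_preimage coord set0.
Proof. exact: sigma_algebra0. Qed.

Let rV_setC A : g_sigma_preimage coord A -> g_sigma_preimage coord (~` A).
Proof. exact: sigma_algebraC. Qed.

Let rV_bigcup (F : _^nat) : (forall i, g_sigma_preimage coord (F i)) ->
  g_sigma_preimage coord (\bigcup_i (F i)).
Proof. exact: sigma_algebra_bigcup. Qed.

HB.instance Definition _ := @isMeasurable.Build measure_rV_display
  'rV[R]_n (g_sigma_preimage coord) rV_set0 rV_setC rV_bigcup.

End measurable_rV.

Lemma measurable_coord (R : realType) n (i : 'I_n) :
  measurable_fun [set: 'rV[R]_n] (fun x : 'rV[R]_n => x ord0 i).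
Proof.
move=> _ Y mY; rewrite setTI; apply: sub_sigma_algebra => /=.
rewrite -bigcup_seq/=; exists i => /=; first by rewrite mem_index_enum.
by exists Y => //; rewrite setTI.
Qed.

Lemma measurable_fun_coordP (R : realType) n d (T : measurableType d)
    (f : T -> 'rV[R]_n) :
  (forall i, measurable_fun [set: T] (fun t => f t ord0 i)) ->
  measurable_fun [set: T] f.
Proof.
move=> mf.
have -> : measurable_fun [set: T] f <->
    g_sigma_preimage (fun i => (fun x : 'rV[R]_n => x ord0 i : R) \o f)
      `<=` measurable.
  rewrite g_sigma_preimage_comp; split=> [mf' A [/= C preC <-]|prefS].
    exact: mf'.
  by move=> _ A mA; apply: prefS; exists A.
apply: smallest_sub; first exact: sigma_algebra_measurable.
case: n => [|n] in f mf *; first by rewrite big_ord0.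
rewrite -bigcup_mkord_ord; apply: bigcup_sub => i Ii.
by move=> A [B mB <-]; exact: mf.
Qed.

Definition cons_rV (R : realType) n
    (p : 'rV[R]_n * measurableTypeR R) : 'rV[R]_n.+1 :=
  row_mx (const_mx p.2 : 'rV_1) p.1.

Lemma measurable_cons_rV (R : realType) n :
  measurable_fun [set: 'rV[R]_n * measurableTypeR R] (@cons_rV R n).
Proof.
apply: measurable_fun_coordP => i.
have [j ->|j ->] := split_ordP (i : 'I_(1 + n)).
  rewrite (_ : (fun _ => _) = snd) ?funeqE => [|p]; first exact: measurable_snd.
  by apply: (etrans (row_mxEl (const_mx p.2) p.1 ord0 j)); rewrite mxE.
rewrite (_ : (fun _ => _) = (fun x : 'rV[R]_n => x ord0 j) \o fst) ?funeqE => [|p].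
  exact: (measurableT_comp (measurable_coord j) measurable_fst).
exact: (row_mxEr (const_mx p.2) p.1).
Qed.

(* Lebesgue measure on R^n, as an iterated product measure. *)
Fixpoint lebesgue_rV (R : realType) (n : nat) : set 'rV[R]_n -> \bar R :=
  match n with
  | 0 => \d_(0 : 'rV[R]_0)
  | m.+1 => pushforward (@lebesgue_rV R m \x @lebesgue_measure R)%E
              (@cons_rV R m)
  end.
Arguments lebesgue_rV : clear implicits.

Section lebesgue_rV_measure.
Variable R : realType.

Lemma lebesgue_rV_spec n : [/\ lebesgue_rV R n set0 = 0%E,
  (forall A, (0 <= lebesgue_rV R n A)%E) &
  semi_sigma_additive (lebesgue_rV R n)].
Proof.
elim: n => [|n [h0 hge hs]].
  split; [exact: measure0|exact: measure_ge0|].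
  exact: measure_semi_sigma_additive.
pose M := isMeasure.Build _ _ _ (lebesgue_rV R n) h0 hge hs.
pose m : {measure set 'rV[R]_n -> \bar R} := HB.pack (lebesgue_rV R n) M.
pose p : {measure set ('rV[R]_n * measurableTypeR R) -> \bar R} :=
  (m \x @lebesgue_measure R)%E.
have mc := @measurable_cons_rV R n.
pose q : {measure set 'rV[R]_n.+1 -> \bar R} :=
  measure_function_pushforward__canonical__measure_function_Measure
    p mc.
split; [exact: (measure0 q)|exact: (measure_ge0 q)|].
exact: (@measure_semi_sigma_additive _ _ _ q).
Qed.

Variable n : nat.
Let leb0 : lebesgue_rV R n set0 = 0%E.
Proof. by have [] := lebesgue_rV_spec n. Qed.
Let leb_ge0 A : (0 <= lebesgue_rV R n A)%E.
Proof. by have [] := lebesgue_rV_spec n. Qed.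
Let leb_sigma : semi_sigma_additive (lebesgue_rV R n).
Proof. by have [] := lebesgue_rV_spec n. Qed.

HB.instance Definition _ := isMeasure.Build _ _ _ (lebesgue_rV R n)
  leb0 leb_ge0 leb_sigma.

End lebesgue_rV_measure.

Lemma measurable_rVE (R : realType) (n : nat) :
  (measurable : set (set 'rV[R]_n)) = <<s (open : set (set 'rV[R]_n)) >>.
Proof.
rewrite eqEsubset; split.
- apply: smallest_sub; first exact: smallest_sigma_algebra.
  rewrite -bigcup_seq => A [i _ [B mB <-]].
  pose f (x : g_sigma_algebraType (open : set (set 'rV[R]_n))) : R := x ord0 i.
  suff mf : measurable_fun setT f by exact: mf.
  apply: (measurability _ (measurable_realfun.RGenOpens.measurableE R)) => //.
  move=> _ [_ [a [b ->] <-]]; rewrite setTI; apply: sub_sigma_algebra.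
  by apply: open_comp => [x _|]; [exact: coord_continuous|exact: interval_open].
- apply: smallest_sub; first exact: sigma_algebra_measurable.
  move=> U oU.
  pose box (p : {ffun 'I_n -> rat * rat}) : set 'rV[R]_n :=
    [set x | forall i, x ord0 i \in `]ratr (p i).1, ratr (p i).2[%R].
  pose F k := if unpickle k is Some p then
    (if `[< box p `<=` U >] then box p else set0) else set0.
  have mbox p : measurable (box p).
    rewrite (_ : box p = \bigcap_(i in [set: 'I_n])
        ((fun x : 'rV[R]_n => x ord0 i) @^-1` `]ratr (p i).1, ratr (p i).2[)).
      apply: fin_bigcap_measurable => // i _; rewrite -[X in measurable X]setTI.
      by apply: measurable_coord => //; exact: measurable_itv.
    by apply/seteqP; split=> [x Hx i _|x Hx i]; [exact: Hx|exact: (Hx i I)].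
  rewrite (_ : U = \bigcup_k F k).
    apply: bigcup_measurable => k _; rewrite /F.
    by case: unpickle => // p; case: ifP.
  apply/seteqP; split=> [x Ux|x [k _]]; last first.
    by rewrite /F; case: unpickle => // p; case: asboolP => // + pH; exact.
  have /nbhs_ballP[e /= e0 eU] : nbhs x U by apply: open_nbhs_nbhs.
  have /(_ _)/cid lo i : exists q : rat, ratr q \in `]x ord0 i - e, x ord0 i[.
    by apply: rat_in_itvoo; rewrite ltrBlDr ltrDl.
  have /(_ _)/cid hi i : exists q : rat, ratr q \in `]x ord0 i, x ord0 i + e[.
    by apply: rat_in_itvoo; rewrite ltrDl.
  pose p := [ffun i => (sval (lo i), sval (hi i))].
  have pU : box p `<=` U.
    move=> y py; apply: eU; split=> // j i; rewrite (ord1 j).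
    have := py i; rewrite ffunE /=.
    have := svalP (lo i); have := svalP (hi i); rewrite !in_itv/=.
    move=> /andP[? ?] /andP[? ?] /andP[? ?].
    by rewrite /ball/= ltr_distlC; apply/andP; split; lra.
  exists (pickle p) => //; rewrite /F pickleK asboolT// => i.
  rewrite ffunE in_itv/=.
  have := svalP (lo i); have := svalP (hi i); rewrite !in_itv/=.
  by move=> /andP[-> _] /andP[_ ->].
Qed.

Lemma lebesgue_rV_box (R : realType) (n : nat) (a b : 'I_n -> R) :
  (forall i, a i <= b i) ->
  lebesgue_rV R n [set x | forall i, x ord0 i \in `]a i, b i]] =
  (\prod_(i < n) (b i - a i))%:E.
Proof.
elim: n a b => [|n IH] a b ab.
  rewrite big_ord0/= diracE; case: (boolP (_ \in _)) => //.
  by rewrite notin_setE/=; case=> -[].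
pose a' (i : 'I_n) := a (lift ord0 i); pose b' (i : 'I_n) := b (lift ord0 i).
transitivity ((lebesgue_rV R n \x @lebesgue_measure R)%E
   ([set x : 'rV[R]_n | forall i, x ord0 i \in `]a' i, b' i]] `*`
    `]a ord0, b ord0])).
  rewrite /= /pushforward; congr product_measure1.
  have E0 p : @cons_rV R n p ord0 ord0 = p.2.
    have -> : ord0 = lshift n (ord0 : 'I_1) by apply/val_inj.
    by apply: (etrans (row_mxEl (const_mx p.2) p.1 ord0 _)); rewrite mxE.
  have E1 p i : @cons_rV R n p ord0 (lift ord0 i) = p.1 ord0 i.
    have -> : lift ord0 i = rshift 1 i by apply/val_inj.
    exact: (row_mxEr (const_mx p.2) p.1).
  apply/seteqP; split=> [p/= Hp|p/= [H1 H2] i].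
    by split=> [i|]; [have := Hp (lift ord0 i)|have := Hp ord0]; rewrite ?E1 ?E0.
  by case: (unliftP ord0 i) => [j ->|->]; rewrite ?E1 ?E0//; exact: H1.
rewrite product_measure1E//.
- rewrite big_ord_recl mulrC EFinM; congr (_ * _)%E.
    by apply: (IH a' b') => i; exact: ab.
  apply: (etrans (lebesgue_measure_itv `]a ord0, b ord0])).
  rewrite /= lte_fin; case: ltP => [_|ba]; first by rewrite EFinB.
  have -> : b ord0 = a ord0 by apply/eqP; rewrite eq_le ba ab.
  by rewrite subrr.
- rewrite (_ : mkset _ = \bigcap_(i in [set: 'I_n])
      ((fun x : 'rV[R]_n => x ord0 i) @^-1` `]a' i, b' i])).
    apply: fin_bigcap_measurable => // i _; rewrite -[X in measurable X]setTI.
    by apply: measurable_coord => //; exact: measurable_itv.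
  by apply/seteqP; split=> [x Hx i _|x Hx i]; [exact: Hx|exact: (Hx i I)].
Qed.

Fixpoint Ck (R : realType) (V W : normedModType R) (k : nat) (f : V -> W)
    : Prop :=
  if k is k'.+1 then
    continuous f /\
    forall v : V, (forall x, derivable f x v) /\ Ck k' (fun x => 'D_v f x)
  else continuous f.

Definition smooth (R : realType) (V W : normedModType R) (f : V -> W) : Prop :=
  forall k, Ck k f.

Definition dilation (R : realType) (N : nat) (nu : 'I_N -> R) (lambda : R)
    (x : 'rV[R]_N) : 'rV[R]_N :=
  \row_i (lambda `^ nu i * x ord0 i).

Record homogeneous_group (R : realType) (N : nat) := HomogeneousGroup {
  hg_mul : 'rV[R]_N -> 'rV[R]_N -> 'rV[R]_N ;
  hg_inv : 'rV[R]_N -> 'rV[R]_N ;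
  hg_weight : 'I_N -> R ;
  hg_mulA : associative hg_mul ;
  hg_mul0x : left_id 0 hg_mul ;
  hg_mulx0 : right_id 0 hg_mul ;
  hg_mulVx : left_inverse 0 hg_inv hg_mul ;
  hg_mulxV : right_inverse 0 hg_inv hg_mul ;
  hg_mul_smooth : smooth (fun p : 'rV[R]_N * 'rV[R]_N => hg_mul p.1 p.2) ;
  hg_inv_smooth : smooth hg_inv ;
  hg_weight_gt0 : forall i, 0 < hg_weight i ;
  hg_dilM : forall lambda, 0 < lambda ->
    {morph dilation hg_weight lambda : x y / hg_mul x y} }.

Section homogeneous_group_theory.
Variables (R : realType) (N : nat).
Implicit Types (G : homogeneous_group R N) (qn : 'rV[R]_N -> R).

Local Notation mu := (lebesgue_rV R N).

Definition dil G : R -> 'rV[R]_N -> 'rV[R]_N := dilation (hg_weight G).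

Definition hom_dim G : R := \sum_(i < N) hg_weight G i.

Record quasi_norm G qn : Prop := QuasiNorm {
  qn_continuous : continuous qn ;
  qn_ge0 : forall x, 0 <= qn x ;
  qn_inv : forall x, qn (hg_inv G x) = qn x ;
  qn_dil : forall lambda x, 0 < lambda -> qn (dil G lambda x) = lambda * qn x ;
  qn_eq0 : forall x, qn x = 0 <-> x = 0 }.

Definition quasi_sphere qn : set 'rV[R]_N := [set x | qn x = 1].

(* A measure on the unit quasi-sphere is encoded as a Borel measure on R^N
   that vanishes off the sphere; on R^N, Radon amounts to being finite on
   compact sets. *)
Record polar_measure G qn (sigma : {measure set 'rV[R]_N -> \bar R})
    : Prop := PolarMeasure {
  polar_radon : forall K, compact K -> (sigma K < +oo)%E ;
  polar_support : sigma (~` quasi_sphere qn) = 0%E ;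
  polar_formula : forall f : 'rV[R]_N -> R,
    mu.-integrable setT (EFin \o f) ->
    (\int[mu]_x (f x)%:E =
     \int[lebesgue_measure]_(r in `]0%R, +oo[)
       \int[sigma]_(y in quasi_sphere qn)
         (f (dil G r y) * r `^ (hom_dim G - 1))%:E)%E }.

Definition japanese qn (x : 'rV[R]_N) : R := Num.sqrt (1 + qn x ^+ 2).

Definition L1_weighted qn (alpha : R) (u : 'rV[R]_N -> R) : Prop :=
  [/\ measurable_fun setT u,
      forall K, compact K -> mu.-integrable K (EFin \o u) &
      mu.-integrable setT (fun x => (japanese qn x `^ alpha * u x)%:E)].

Definition ae_zero (u : 'rV[R]_N -> R) : Prop := {ae mu, forall x, u x = 0}.

Definition L1norm (u : 'rV[R]_N -> R) : R := fine ('N[mu]_1 [EFin \o u])%E.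

(* Since ln 0 = 0, the convention 0 log(1/0) = 0 is built in. *)
Definition entropy_density (u : 'rV[R]_N -> R) (x : 'rV[R]_N) : R :=
  `|u x| / L1norm u * ln ((`|u x| / L1norm u)^-1).

Definition entropy (u : 'rV[R]_N -> R) : \bar R :=
  (\int[mu]_x (entropy_density u x)%:E)%E.

(* The library's integral is the difference of the integrals of the positive
   and negative parts, with +oo - oo = -oo; it is a genuine value in
   [-oo, +oo[ exactly when the positive part is integrable. *)
Definition entropy_well_defined (u : 'rV[R]_N -> R) : Prop :=
  (\int[mu]_x (EFin \o entropy_density u)^\+ x < +oo)%E.

Definition entropy_bound (Q alpha A : R) qn (u : 'rV[R]_N -> R) : R :=
  Q / alpha * ln (alpha * expR 1 * A / Q *
    (L1norm (fun x => qn x `^ alpha * u x) / L1norm u)).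

Definition extremal (alpha A : R) qn (x : 'rV[R]_N) : R :=
  expR (- (A * qn x `^ alpha)).

End homogeneous_group_theory.

Definition Gamma (R : realType) (s : R) : R :=
  \int[lebesgue_measure]_(t in `]0, +oo[) (t `^ (s - 1) * expR (- t)).

(* Main.v *)
Require Import Defs.
From mathcomp Require Import all_boot all_order all_algebra.
From mathcomp Require Import all_classical all_reals all_analysis.
From mathcomp Require Import measurable_realfun.
From mathcomp Require Import ring lra.
Set Implicit Arguments.
Unset Strict Implicit.
Unset Printing Implicit Defensive.
Import Order.TTheory GRing.Theory Num.Theory.
Import numFieldNormedType.Exports.
Local Open Scope classical_set_scope.
Local Open Scope ring_scope.

(** The inequality is Gibbs' inequality. Let f = |u| / ||u||_1, a probability
density, and for l > 0 compare it with the density proportional to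
exp (- l |x|^alpha), whose mass is Z(l). Integrating the pointwise bound
f log (1/f) <= f log (1/g) + g - f, where g = exp (- l |x|^alpha) / Z(l), gives
entropy u <= l m + log Z(l), where m is the mean of |x|^alpha under f.

The mass is computed by polar coordinates ([radial_integral]) and the
substitution t = l r^alpha ([integral_expRN_powR]):
Z(l) = |S| Gamma(Q/alpha) / alpha * l^(-Q/alpha) = (A / l)^(Q/alpha), the last
equality being the definition of A. The right-hand side is then
l m + (Q/alpha) log (A / l), which is least at l = Q / (alpha m); its value
there is the stated bound ([entropy_le_bound]).

For the extremal E = exp (- A |x|^alpha), of mass 1, the entropy is exactly A m.
With x = alpha A m / Q the bound equals (Q/alpha) (1 + log x), which is at most
(Q/alpha) x = A m because log x <= x - 1. So the bound never exceeds the entropy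
of E, and the inequality already proved forces equality ([entropy_extremal]).
Since the bound is strictly increasing in the constant, equality at E also rules
out every smaller constant.

The polar formula concerns integrable functions, so the integrability of these
exponentials has to come first. A radial profile is therefore cut off to
quasi-balls, which have finite measure because homogeneity makes a
quasi-norm dominate every coordinate ([coord_le_quasi_norm]), and the cutoff is
removed by monotone convergence. *)

(** * Power substitutions on the half-line *)

Section power_substitution.
Context {R : realType}.
Local Notation leb := (@lebesgue_measure R).
Implicit Types (a b p c x y : R) (g : R -> R).

Lemma continuous_powR p x : 0 < x -> {for x, continuous (@powR R ^~ p)}.
Proof.
move=> x0; apply/differentiable_continuous/derivable1_diffP.
by apply: derivable_powR; rewrite in_itv/= x0.
Qed.

Lemma derivable_scale_powR c p x : 0 < x ->
  derivable (fun y : R => c * y `^ p) x 1.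
Proof.
by move=> x0; apply: derivableM => //; apply: derivable_powR; rewrite in_itv/= x0.
Qed.

Lemma scale_powR_derive1 c p x : 0 < x ->
  (fun y : R => c * y `^ p)^`()%classic x = c * p * x `^ (p - 1).
Proof.
move=> x0; rewrite derive1E deriveM//; last first.
  by apply: derivable_powR; rewrite in_itv/= x0.
rewrite derive_cst scaler0 addr0 -derive1E powR_derive1 ?in_itv/= ?x0//.
by rewrite scalerAl.
Qed.

Lemma continuous_scale_powR c p x : 0 < x ->
  {for x, continuous (fun y : R => c * y `^ p)}.
Proof.
by move=> x0; apply: cvgM; [exact: cvg_cst|exact: continuous_powR].
Qed.

Lemma continuous_scale_powR_derive1 c p x : 0 < x ->
  {for x, continuous (fun y : R => c * y `^ p)^`()%classic}.
Proof.
move=> x0; suff : (fun y => c * y `^ p)^`()%classic y @[y --> x] --> c * p * x `^ (p - 1).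
  by rewrite -(scale_powR_derive1 c p x0).
apply: (@cvg_trans _ ((fun y : R => (c * p) * y `^ (p - 1)) @ x)); last first.
  exact: continuous_scale_powR.
apply: near_eq_cvg; near=> y; rewrite scale_powR_derive1//.
by near: y; exact: lt_nbhsr.
Unshelve. all: by end_near. Qed.

(** Away from 0 the derivative of c x^p is bounded, so the substitution rule for
increasing functions applies; at 0 it may blow up or vanish, which is why
[powR_substitution] is reached by exhausting the half-line. *)
Lemma powR_substitution_segment c p g a b : 0 < c -> 0 < p ->
  {in `]0, +oo[, continuous g} -> 0 < a -> a <= b ->
  (\int[leb]_(x in `[(c * a `^ p)%R, (c * b `^ p)%R]) (g x)%:E =
   \int[leb]_(x in `[a, b]) (g (c * x `^ p) * (c * p * x `^ (p - 1)))%R%:E)%E.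
Proof.
move=> c0 p0 cg a0 ab.
have b0 : 0 < b by exact: lt_le_trans ab.
have pos x : x \in `[a, b] -> 0 < x.
  by rewrite in_itv/= => /andP[+ _]; exact: lt_le_trans.
rewrite (@integration_by_substitution_increasing _ (fun y => c * y `^ p))//.
- apply: eq_integral => x; rewrite inE/= => /pos x0.
  by rewrite fctE /= scale_powR_derive1.
- move=> x y xab yab xy; rewrite ltr_pM2l// gt0_ltr_powR// nnegrE ltW//;
    exact: pos.
- move=> x /subset_itv_oo_cc/pos x0; exact: continuous_scale_powR_derive1.
- apply/cvg_ex; exists ((fun y => c * y `^ p)^`()%classic a).
  by apply: cvg_at_right_filter; exact: continuous_scale_powR_derive1.
- apply/cvg_ex; exists ((fun y => c * y `^ p)^`()%classic b).
  by apply: cvg_at_left_filter; exact: continuous_scale_powR_derive1.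
- split.
  + by move=> x /subset_itv_oo_cc/pos; exact: derivable_scale_powR.
  + by apply: cvg_at_right_filter; exact: continuous_scale_powR.
  + by apply: cvg_at_left_filter; exact: continuous_scale_powR.
- apply: continuous_in_subspaceT => x; rewrite inE/= in_itv/= => /andP[ax _].
  apply: cg; rewrite in_itv/= andbT (lt_le_trans _ ax)//.
  by rewrite mulr_gt0// powR_gt0.
Qed.

(** Monotone convergence along the segments [1/(n+1), n+1] and their images; both
sides may be infinite. *)
Lemma powR_substitution c p g : 0 < c -> 0 < p ->
  {in `]0, +oo[, continuous g} -> (forall x, 0 < x -> 0 <= g x) ->
  (\int[leb]_(x in `]0%R, +oo[) (g x)%:E =
   \int[leb]_(x in `]0%R, +oo[) (g (c * x `^ p) * (c * p * x `^ (p - 1)))%R%:E)%E.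
Proof.
move=> c0 p0 cg g0.
pose F y := c * y `^ p.
pose a (n : nat) : R := n.+1%:R^-1; pose b (n : nat) : R := n.+1%:R.
have a0 n : 0 < a n by rewrite invr_gt0.
have b0 n : 0 < b n by [].
have ab n : a n <= b n by rewrite (@le_trans _ _ 1)// ?invf_le1// ler1n.
have leF x y : 0 < x -> x <= y -> F x <= F y.
  move=> x0 xy; have y0 := lt_le_trans x0 xy.
  by rewrite ler_pM2l// ge0_ler_powR ?nnegrE ?(ltW p0) ?(ltW x0) ?(ltW y0).
have aN m n : (m <= n)%N -> a n <= a m by move=> mn; rewrite lef_pV2 ?posrE// ler_nat.
have bN m n : (m <= n)%N -> b m <= b n by move=> mn; rewrite ler_nat.
have F0 x : 0 < x -> 0 < F x by move=> x0; rewrite mulr_gt0// powR_gt0.  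
have in_ab x : 0 < x -> exists n, a n <= x <= b n.
  move=> x0; exists (Num.truncn (Num.max x x^-1)).
  have := truncnS_gt (Num.max x x^-1).
  rewrite gt_max => /andP[xb xVb]; rewrite (ltW xb) andbT ltW//.
  by rewrite invf_plt ?posrE.
have E1 : `]0%R, +oo[%classic = \bigcup_n `[F (a n), F (b n)]%classic.
  apply/seteqP; split=> [x /=|x [n _] /=]; rewrite !in_itv/= ?andbT; last first.
    by case/andP => + _; apply: lt_le_trans; exact: F0.
  move=> x0; pose y := (x / c) `^ p^-1.
  have xc0 : 0 < x / c by rewrite divr_gt0.
  have y0 : 0 < y by rewrite powR_gt0.
  have [n /andP[ay yb]] := in_ab y y0; exists n => //=; rewrite in_itv/=.
  have -> : x = F y.
    by rewrite /F /y -powRrM mulVf ?gt_eqF// powRr1 ?ltW// mulrC divfK// gt_eqF.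
  by rewrite !leF.
have E2 : `]0%R, +oo[%classic = \bigcup_n `[a n, b n]%classic.
  apply/seteqP; split=> [x /=|x [n _] /=]; rewrite !in_itv/= ?andbT; last first.
    by case/andP => + _; exact: lt_le_trans.
  by move=> /in_ab[n ?]; exists n => //=; rewrite in_itv.
rewrite [in LHS]E1 [in RHS]E2.
have mg : measurable_fun (`]0%R, +oo[%classic : set R) g.
  by apply: open_continuous_measurable_fun => // x; rewrite inE/= => /cg.
have mF : measurable_fun setT F.
  by apply: measurable_funM => //; exact: measurable_powR.
have /cvg_lim <-// : (\int[leb]_(x in `[F (a n), F (b n)]) (g x)%:E)%E
    @[n --> \oo] --> (\int[leb]_(x in \bigcup_n `[F (a n), F (b n)]%classic) (g x)%:E)%E.
  apply: (@ge0_nondecreasing_set_cvg_integral _ (measurableTypeR R)) => [m n mn|n|n|n x].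
  - rewrite subsetEset => x /=; rewrite !in_itv/= => /andP[ax xb].
    rewrite (le_trans _ ax) ?(le_trans xb)//; apply: leF => //; first exact: bN.
    exact: aN.
  - exact: measurable_itv.
  - apply/measurable_EFinP; apply: measurable_funS mg => //.
    move=> x /=; rewrite !in_itv/= andbT => /andP[+ _]; apply: lt_le_trans.
    exact: F0.
  - rewrite /= in_itv/= => /andP[/(lt_le_trans (F0 _ (a0 n))) x0 _].
    by rewrite lee_fin g0.
have /cvg_lim <-// : (\int[leb]_(x in `[a n, b n])
      (g (F x) * (c * p * x `^ (p - 1)))%R%:E)%E @[n --> \oo] -->
    (\int[leb]_(x in \bigcup_n `[a n, b n]%classic)
      (g (F x) * (c * p * x `^ (p - 1)))%R%:E)%E.
  apply: (@ge0_nondecreasing_set_cvg_integral _ (measurableTypeR R)) => [m n mn|n|n|n x].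
  - rewrite subsetEset => x /=; rewrite !in_itv/= => /andP[ax xb].
    by rewrite (le_trans _ ax) ?(le_trans xb)//; [exact: bN|exact: aN].
  - exact: measurable_itv.
  - apply/measurable_EFinP; apply: measurable_funM.
      apply: (measurable_comp _ _ mg (measurable_funTS mF)) => //.
      move=> _ [x /=] /[swap] <-; rewrite !in_itv/= andbT => /andP[ax _].
      exact/F0/(lt_le_trans (a0 n)).
    by apply: measurable_funM => //; apply: measurable_funTS; exact: measurable_powR.
  - rewrite /= in_itv/= => /andP[/(lt_le_trans (a0 n)) x0 _].
    by rewrite lee_fin mulr_ge0// ?g0 ?F0// ?mulr_ge0 ?powR_ge0// ltW.
by congr (limn _); apply/funext => n; exact: powR_substitution_segment.
Qed.

End power_substitution.

(** * The Gamma integral *)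

Section Gamma_integral.
Context {R : realType}.
Local Notation leb := (@lebesgue_measure R).
Implicit Types (a l p q s x : R).

Lemma continuous_Gamma_integrand s :
  {in `]0, +oo[, continuous (fun t : R => t `^ (s - 1) * expR (- t))}.
Proof.
move=> t; rewrite in_itv/= andbT => t0.
apply: cvgM; first exact: continuous_powR.
by apply: (cvg_comp _ _ (cvgN cvg_id)); exact: continuous_expR.
Qed.

(** The exponential beats every power, in particular (x^p)^k >= x^2 for x >= 1 and
k >= 2 / p.
The majorant is chosen because its integral is known from the arctangent. *)
Lemma expRN_powR_le p : 0 < p -> exists C : R, forall x, 0 <= x ->
  expR (- x `^ p) <= C * (1 + x ^+ 2)^-1.
Proof.
move=> p0; pose k := (Num.truncn (2 / p)).+1.
exists (2 + k`!%:R) => x x0.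
have xp0 : 0 <= x `^ p by exact: powR_ge0.
have k2 : 2 / p <= k%:R by exact/ltW/truncnS_gt.
have xk : (x `^ p) ^+ k <= k`!%:R * expR (x `^ p).
  rewrite mulrC -ler_pdivrMr ?ltr0n ?fact_gt0//.
  by apply: le_trans (expR_ge1Dxn (Num.truncn (2 / p)) xp0); rewrite lerDr.
have e1 : 1 <= expR (x `^ p) by rewrite -expR0 ler_expR.
rewrite ler_pdivlMr ?ltr_pwDl ?sqr_ge0// expRN mulrC ler_pdivrMr ?expR_gt0//.
have x2 : x ^+ 2 <= 1 + (x `^ p) ^+ k.
  have [x1|/ltW x1] := leP x 1.
    apply: (@le_trans _ _ 1); first by rewrite expr_le1.
    by rewrite lerDl exprn_ge0.
  rewrite -!powR_mulrn// -powRrM.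
  apply: (@le_trans _ _ (x `^ (p * k%:R))); last by rewrite lerDr.
  by rewrite ler_powR// mulrC -ler_pdivrMr.
rewrite mulrDl; lra.
Qed.

Lemma integral_expRN_powR_fin p : 0 < p ->
  (\int[leb]_(x in `]0%R, +oo[) (expR (- x `^ p))%:E < +oo)%E.
Proof.
move=> p0; have [C Cle] := expRN_powR_le p0.
have C0 : 0 <= C.
  have := Cle 0 (lexx _); rewrite expr0n/= addr0 invr1 mulr1.
  by apply: le_trans; exact: expR_ge0.
have m1 : measurable_fun [set: R] (fun x => expR (- x `^ p)).
  by apply: measurableT_comp => //; apply: measurableT_comp => //.
have m2 : measurable_fun [set: R] (fun x : R => (1 + x ^+ 2)^-1).
  exact: continuous_measurable_fun (@continuous_oneDsqrV R).
apply: (@le_lt_trans _ _ (C%:E * \int[leb]_(x in `[0%R, +oo[) ((1 + x ^+ 2)^-1)%:E)%E); last first.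
  by rewrite integral0y_oneDsqr -EFinM ltry.
rewrite -ge0_integralZl//; last 2 first.
- by apply/measurable_EFinP; exact: measurable_funTS.
- by move=> x _; rewrite lee_fin invr_ge0 addr_ge0 ?sqr_ge0.
rewrite integral_itv_obnd_cbnd; last by apply/measurable_EFinP; exact: measurable_funTS.
apply: ge0_le_integral => //.
- by apply/measurable_EFinP; exact: measurable_funTS.
- by apply/measurable_EFinP; apply: measurable_funM => //; exact: measurable_funTS.
- by move=> x; rewrite /= in_itv/= andbT => x0; rewrite -EFinM lee_fin Cle.
Qed.

(** The substitution w = t^s turns the Gamma integral into s^-1 times the integral
of exp (- w^(1/s)), which removes the singularity at 0; hence the integral is
finite and [Gamma] is its actual value. *)
Lemma integral_Gamma s : 0 < s ->
  (\int[leb]_(t in `]0%R, +oo[) (t `^ (s - 1) * expR (- t))%:E = (Gamma s)%:E)%E.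
Proof.
move=> s0; rewrite /Gamma /Rintegral fineK// ge0_fin_numE; last first.
  by apply: integral_ge0 => t _; rewrite lee_fin mulr_ge0 ?powR_ge0 ?expR_ge0.
have cg : {in `]0, +oo[, continuous (fun w : R => expR (- w `^ s^-1))}.
  move=> w; rewrite in_itv/= andbT => w0.
  apply: (cvg_comp _ _ (cvgN _)); last exact: continuous_expR.
  exact: continuous_powR.
have sV0 : 0 < s^-1 by rewrite invr_gt0.
suff : (s%:E * \int[leb]_(t in `]0%R, +oo[) (t `^ (s - 1) * expR (- t))%:E < +oo)%E.
  by rewrite -[X in (_ < X)%E](@gt0_muley _ s%:E) ?lte_fin// lte_pmul2l.
apply: le_lt_trans (integral_expRN_powR_fin sV0).
rewrite (powR_substitution ltr01 s0 cg); last by move=> *; exact: expR_ge0.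
rewrite -ge0_integralZl//; last 3 first.
- apply/measurable_EFinP; apply: open_continuous_measurable_fun => // t.
  rewrite inE/=; exact: continuous_Gamma_integrand.
- by move=> t _; rewrite lee_fin mulr_ge0 ?powR_ge0 ?expR_ge0.
- by rewrite lee_fin ltW.
rewrite le_eqVlt; apply/orP; left; apply/eqP; apply: eq_integral => t.
rewrite inE/= in_itv/= andbT => t0.
by rewrite !mul1r -powRrM mulfV ?gt_eqF// powRr1 ?ltW// -EFinM; congr EFin; ring.
Qed.

(** The substitution t = l r^a in the Gamma integral. *)
Lemma integral_expRN_powR a l q : 0 < a -> 0 < l -> 0 < q ->
  (\int[leb]_(r in `]0%R, +oo[) (expR (- (l * r `^ a)) * r `^ (q - 1))%:E =
   (l `^ (- (q / a)) * (Gamma (q / a) / a))%:E)%E.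
Proof.
move=> a0 l0 q0; have s0 : 0 < q / a by rewrite divr_gt0.
have c0 : 0 < l `^ (q / a) * a by rewrite mulr_gt0// powR_gt0.
have : (\int[leb]_(r in `]0%R, +oo[) ((l `^ (q / a) * a)%:E *
   (expR (- (l * r `^ a)) * r `^ (q - 1))%:E) = (Gamma (q / a))%:E)%E.
  rewrite -integral_Gamma// (powR_substitution l0 a0 (@continuous_Gamma_integrand _)).
    apply: eq_integral => r; rewrite inE/= in_itv/= andbT => r0.
    rewrite -EFinM; congr EFin.
    have -> : (l * r `^ a) `^ (q / a - 1) = l `^ (q / a) / l * r `^ (q - a).
      rewrite powRM ?powR_ge0 ?(ltW l0)// -powRrM mulrBr mulr1 [a * _]mulrC divfK ?gt_eqF//.
      rewrite [l `^ (q / a - 1)]powRB; last by rewrite (gt_eqF l0) implybT.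
      by rewrite powRr1 ?ltW.
    have -> : r `^ (q - 1) = r `^ (q - a) * r `^ (a - 1).
      by rewrite -powRD ?(gt_eqF r0) ?implybT// addrA subrK.
    by field; rewrite gt_eqF.
  by move=> x x0; rewrite mulr_ge0 ?powR_ge0 ?expR_ge0.
rewrite ge0_integralZl//; last 3 first.
- apply/measurable_EFinP; apply: measurable_funTS; apply: measurable_funM.
    apply: measurableT_comp => //; apply: measurableT_comp => //.
    by apply: measurable_funM => //; exact: measurable_powR.
  exact: measurable_powR.
- by move=> t _; rewrite lee_fin mulr_ge0 ?powR_ge0 ?expR_ge0.
- by rewrite lee_fin ltW.
move=> /(congr1 (fun x : \bar R => (((l `^ (q / a) * a)^-1)%:E * x)%E)).
rewrite muleA -EFinM mulVf ?gt_eqF// mul1e => ->.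
by rewrite -EFinM powRN invfM; congr EFin; ring.
Qed.

End Gamma_integral.

(** * Quasi-norms and Lebesgue measure *)

Lemma continuous_measurable_rV (R : realType) (N : nat) (f : 'rV[R]_N -> R) :
  continuous f -> measurable_fun setT f.
Proof.
move=> /continuousP cf.
apply: (measurability _ (measurable_realfun.RGenOpens.measurableE R)) => //.
move=> _ [_ [a [b ->] <-]]; rewrite setTI measurable_rVE.
by apply: sub_sigma_algebra; apply: cf; exact: interval_open.
Qed.

Lemma rV_norm_ge_coord (R : realType) (N : nat) (x : 'rV[R]_N) i :
  `|x ord0 i| <= `|x|.
Proof.
rewrite [leRHS]/Num.norm /= mx_normrE.
exact: (le_bigmax _ (fun ij => `|x ij.1 ij.2|) (ord0, i)).
Qed.

Lemma rV_norm_le (R : realType) (N : nat) (x : 'rV[R]_N) (M : R) : 0 <= M ->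
  (forall i, `|x ord0 i| <= M) -> `|x| <= M.
Proof.
move=> M0 xM; rewrite [leLHS]/Num.norm /= mx_normrE.
by apply: bigmax_le => // -[i j] _ /=; rewrite (ord1 i).
Qed.

Lemma measurable_rV_box (R : realType) (N : nat) (a b : 'I_N -> R) :
  measurable [set x : 'rV[R]_N | forall i, x ord0 i \in `]a i, b i]].
Proof.
rewrite (_ : mkset _ = \bigcap_(i in [set: 'I_N])
    ((fun x : 'rV[R]_N => x ord0 i) @^-1` `]a i, b i])).
  apply: fin_bigcap_measurable => // i _; rewrite -[X in measurable X]setTI.
  by apply: measurable_coord => //; exact: measurable_itv.
by apply/seteqP; split=> [x Hx i _|x Hx i]; [exact: Hx|exact: (Hx i I)].
Qed.

Lemma lebesgue_rV_gt0 (R : realType) (N : nat) : (0 < lebesgue_rV R N setT)%E.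
Proof.
have := @lebesgue_rV_box R N (fun=> 0) (fun=> 1) (fun=> ler01).
rewrite big1 => [b1|i _]; last by rewrite subr0.
apply: (@lt_le_trans _ _ 1%E); first exact: lte01.
by rewrite -b1; apply: le_measure; rewrite ?inE//; exact: measurable_rV_box.
Qed.

Lemma measurable_rV_origin (R : realType) (N : nat) :
  measurable [set 0 : 'rV[R]_N].
Proof.
rewrite (_ : [set 0] = setT `&` Num.norm @^-1` [set (0 : R)]).
  by apply: (continuous_measurable_rV (@norm_continuous _ _)).
by rewrite setTI; apply/seteqP; split=> x /= => [->|/normr0_eq0->//]; rewrite normr0.
Qed.

(** The origin lies in cubes of arbitrarily small volume. *)
Lemma lebesgue_rV_origin (R : realType) (N : nat) : (0 < N)%N ->
  lebesgue_rV R N [set 0] = 0%E.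
Proof.
move=> N_gt0; apply/eqP; rewrite eq_le measure_ge0 andbT.
apply/lee_addgt0Pr => e e0; rewrite add0e.
pose d := Num.min e 1; have d0 : 0 < d by rewrite lt_min e0 ltr01.
apply: (@le_trans _ _ (lebesgue_rV R N
    [set x | forall i, x ord0 i \in `](- d)%R, 0%R]])).
  apply: le_measure; rewrite ?inE.
  - exact: measurable_rV_origin.
  - exact: measurable_rV_box.
  - by move=> _ /= -> i; rewrite mxE in_itv/= lexx oppr_lt0 d0.
rewrite lebesgue_rV_box => [|_]; last by rewrite oppr_le0 ltW.
under eq_bigr do rewrite sub0r opprK.
rewrite prodr_const card_ord lee_fin (@le_trans _ _ d) ?ge_min ?lexx//.
by rewrite -(prednK N_gt0) exprS ler_piMr ?exprn_ile1 ?ge_min ?lexx ?orbT// ltW.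
Qed.

Section quasi_norm_geometry.
Context {R : realType} {N : nat} {G : homogeneous_group R N}.
Hypothesis N_gt0 : (0 < N)%N.
Variable qn : 'rV[R]_N -> R.
Hypothesis qnP : quasi_norm G qn.
Implicit Types x : 'rV[R]_N.

Lemma quasi_norm_gt0 x : x != 0 -> 0 < qn x.
Proof.
move=> x0; rewrite lt_neqAle (qn_ge0 qnP) andbT eq_sym.
by apply: contra_neq x0 => /(qn_eq0 qnP).
Qed.

Lemma compact_rV_unit_sphere : compact [set x : 'rV[R]_N | `|x| = 1].
Proof.
apply: bounded_closed_compact.
  by exists 1; split => // M M1 x /= ->; exact: ltW.
rewrite (_ : [set _ | _] = Num.norm @^-1` [set 1])//.
apply: closed_comp; last exact: closed_eq.
by move=> x _; exact: norm_continuous.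
Qed.

(** Let m > 0 be the minimum of the quasi-norm on the unit sphere of the sup norm.
For x <> 0 put t = max_i |x_i|^(1/nu_i): the dilation by 1/t sends x to that
sphere, so m <= |x| / t, that is, |x_i|^(1/nu_i) <= t <= |x| / m. *)
Lemma coord_le_quasi_norm : exists2 c : R, 0 < c &
  forall x i, `|x ord0 i| <= (c * qn x) `^ hg_weight G i.
Proof.
have nu0 := hg_weight_gt0 G.
have [|c] := EVT_min_rV _ compact_rV_unit_sphere
  (continuous_subspaceT (qn_continuous qnP)).
  exists (const_mx 1); apply/eqP; rewrite eq_le rV_norm_le//=; last first.
    by move=> i; rewrite mxE normr1.
  by have := rV_norm_ge_coord (const_mx 1 : 'rV[R]_N) (Ordinal N_gt0); rewrite mxE normr1.
rewrite inE/= => c1 minc.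
have c0 : 0 < qn c by apply: quasi_norm_gt0; rewrite -normr_eq0 c1 oner_eq0.
exists (qn c)^-1 => [|x j]; first by rewrite invr_gt0.
have [->|x0] := eqVneq x 0; first by rewrite mxE normr0 powR_ge0.
pose h i := `|x ord0 i| `^ (hg_weight G i)^-1.
have hK i : `|x ord0 i| = h i `^ hg_weight G i.
  by rewrite -powRrM mulVf ?gt_eqF// powRr1.
have h0 i : 0 <= h i by exact: powR_ge0.
(* 1 / h i is the dilation factor that brings x to the unit sphere. *)
have [i _ himax] := @arg_maxP _ _ _ (Ordinal N_gt0) xpredT h isT.
have hi0 : 0 < h i.
  rewrite lt_neqAle h0 andbT eq_sym; apply: contra_neq x0 => hi0.
  apply/rowP => k; apply/eqP; rewrite mxE -normr_eq0 hK.
  have -> : h k = 0 by apply/eqP; rewrite eq_le h0 andbT -hi0; exact: himax.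
  by rewrite powR0// gt_eqF.
have dilE k : `|dil G (h i)^-1 x ord0 k| = ((h i)^-1 * h k) `^ hg_weight G k.
  by rewrite mxE normrM ger0_norm ?powR_ge0// hK powRM// ltW// invr_gt0.
have d1 : `|dil G (h i)^-1 x| = 1.
  apply/eqP; rewrite eq_le rV_norm_le//= => [|k].
    by rewrite (le_trans _ (rV_norm_ge_coord _ i))// dilE mulVf ?gt_eqF// powR1.
  rewrite dilE -[leRHS](congr1 (fun f => f (hg_weight G k)) (powR1 R)).
  rewrite ge0_ler_powR ?nnegrE ?mulr_ge0 ?invr_ge0// ?(ltW (nu0 _)) ?(ltW hi0)//.
  by rewrite mulrC ler_pdivrMr// mul1r; exact: himax.
have : qn c <= qn (dil G (h i)^-1 x) by apply: minc; rewrite inE.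
rewrite (qn_dil qnP) ?invr_gt0// ler_pdivlMl// -ler_pdivlMr// => hile.
rewrite hK ge0_ler_powR ?nnegrE ?(ltW (nu0 _))//.
  by rewrite mulr_ge0 ?invr_ge0 ?(qn_ge0 qnP)// ltW.
by rewrite mulrC (le_trans _ hile)//; exact: himax.
Qed.

Lemma coord_le_quasi_ball (r : R) : exists2 b : 'I_N -> R, (forall i, 0 <= b i) &
  forall x, qn x <= r -> forall i, `|x ord0 i| <= b i.
Proof.
have [c c0 xc] := coord_le_quasi_norm.
exists (fun i => (c * Num.max 0 r) `^ hg_weight G i) => [i|x xr i].
  exact: powR_ge0.
rewrite (le_trans (xc x i))// ge0_ler_powR ?nnegrE ?(ltW (hg_weight_gt0 _ _))//.
- by rewrite mulr_ge0 ?(qn_ge0 qnP)// ltW.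
- by rewrite mulr_ge0 ?le_max ?lexx// ltW.
- by rewrite ler_pM2l// le_max xr orbT.
Qed.

Lemma measurable_quasi_norm : measurable_fun setT qn.
Proof. by apply: continuous_measurable_rV; exact: (qn_continuous qnP). Qed.

Lemma measurable_quasi_ball r : measurable [set x | qn x <= r].
Proof.
rewrite (_ : [set _ | _] = setT `&` qn @^-1` `]-oo, r]).
  by apply: measurable_quasi_norm => //; exact: measurable_itv.
by rewrite setTI; apply/seteqP; split=> x /=; rewrite in_itv.
Qed.

Lemma quasi_ball_fin r : (lebesgue_rV R N [set x | (qn x <= r)%R] < +oo)%E.
Proof.
have [b b0 xb] := coord_le_quasi_ball r.
have le_b i : - b i - 1 <= b i by have := b0 i; lra.
apply: (@le_lt_trans _ _ (lebesgue_rV R N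
    [set x | forall i, x ord0 i \in `](- b i - 1)%R, b i]])).
  apply: le_measure; rewrite ?inE.
  - exact: measurable_quasi_ball.
  - exact: measurable_rV_box.
  - move=> x /= /xb xbi i; have := xbi i; rewrite ler_norml in_itv/=.
    by move=> /andP[bx ->]; rewrite andbT (lt_le_trans _ bx)// ltrBlDr ltrDl.
by rewrite lebesgue_rV_box// ltry.
Qed.

Lemma compact_quasi_sphere : compact (quasi_sphere qn).
Proof.
have [b b0 xb] := coord_le_quasi_ball 1.
apply: bounded_closed_compact.
  exists (\sum_i b i); split => [|M bM x /= x1]; first exact: num_real.
  have xb1 : qn x <= 1 by rewrite x1.
  rewrite (le_trans _ (ltW bM))// rV_norm_le ?sumr_ge0// => i.
  rewrite (le_trans (xb x xb1 i))// (bigD1 i)//= lerDl sumr_ge0//.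
rewrite (_ : quasi_sphere qn = qn @^-1` [set 1])//.
by apply: closed_comp; [move=> x _; exact: (qn_continuous qnP)|exact: closed_eq].
Qed.

End quasi_norm_geometry.

(** * Integration of radial functions *)

Lemma in_setb (T : Type) (p : pred T) x : (x \in [set y | p y]) = p x.
Proof. by apply/idP/idP; rewrite inE. Qed.

Section radial_integral.
Context {R : realType} {N : nat} {G : homogeneous_group R N}.
Local Notation leb := (@lebesgue_measure R).
Local Notation mu := (lebesgue_rV R N).
Local Notation Q := (hom_dim G).
Hypothesis N_gt0 : (0 < N)%N.
Variable qn : 'rV[R]_N -> R.
Hypothesis qnP : quasi_norm G qn.
Variable sigma : {measure set 'rV[R]_N -> \bar R}.
Hypothesis sigmaP : polar_measure G qn sigma.

Lemma hom_dim_gt0 : 0 < Q.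
Proof.
rewrite /hom_dim (bigD1 (Ordinal N_gt0))//= ltr_pwDl ?hg_weight_gt0//.
by rewrite sumr_ge0// => i _; rewrite ltW// hg_weight_gt0.
Qed.

Lemma measurable_quasi_sphere : measurable (quasi_sphere qn).
Proof.
rewrite (_ : quasi_sphere qn = setT `&` qn @^-1` [set 1]); last by rewrite setTI.
by apply: (measurable_quasi_norm qnP) => //; exact: measurable_set1.
Qed.

Lemma quasi_sphere_fin : sigma (quasi_sphere qn) = (fine (sigma (quasi_sphere qn)))%:E.
Proof.
rewrite fineK// ge0_fin_numE ?measure_ge0//.
exact: (polar_radon sigmaP (compact_quasi_sphere N_gt0 qnP)).
Qed.

Variables (phi : R -> R) (M : R).
Hypothesis mphi : measurable_fun setT phi.
Hypothesis phi_ge0 : forall r, 0 <= phi r.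
Hypothesis phi_le : forall r, phi r <= M.

(** The cut-off profile is bounded and supported in a set of finite measure, hence
integrable, and the polar formula applies to it. On the sphere the dilation by r
has quasi-norm r, so that the inner integral is that of a constant. *)
Lemma radial_integral_ball (n : R) :
  (\int[mu]_(x in [set x | (qn x <= n)%R]) (phi (qn x))%:E =
   sigma (quasi_sphere qn) *
   \int[leb]_(r in `]0%R, +oo[%classic `&` [set r | (r <= n)%R])
     (phi r * r `^ (Q - 1))%:E)%E.
Proof.
pose phin r := if r <= n then phi r else 0.
have phin_ge0 r : 0 <= phin r by rewrite /phin; case: ifP.
have mphin : measurable_fun setT phin.
  apply: measurable_fun_ifT => //.
  exact: measurable_fun_ler.
have mqn := measurable_quasi_norm qnP.
have mB := measurable_quasi_ball qnP n.
have Bfin := quasi_ball_fin N_gt0 qnP n.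
have -> : (\int[mu]_(x in [set x | (qn x <= n)%R]) (phi (qn x))%:E =
    \int[mu]_x (phin (qn x))%:E)%E.
  rewrite integral_mkcond; apply: eq_integral => x _.
  by rewrite patchE (in_setb (fun y => qn y <= n)) /phin; case: ifP.
rewrite (polar_formula sigmaP); last first.
  have : mu.-integrable [set x | qn x <= n] (EFin \o (phi \o qn)).
    apply: measurable_bounded_integrable => //.
      exact/measurable_funTS/measurableT_comp.
    exists M; split; first exact: num_real.
    move=> y My x _ /=; rewrite ger0_norm// (le_trans (phi_le _))//.
    exact: ltW.
  move=> /(integrable_mkcond _ mB); apply: eq_integrable => // x _.
  by rewrite patchE (in_setb (fun y => qn y <= n)) /= /phin; case: ifP.
rewrite integral_mkcondr.
under [in RHS]eq_integral => r _.
  rewrite patchE (in_setb (fun r => r <= n)).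
  rewrite (_ : (if _ then _ else _) = (phin r * r `^ (Q - 1))%:E); last first.
    by rewrite /phin; case: ifP; rewrite ?mul0r.
  over.
rewrite -ge0_integralZl//; last 2 first.
- by apply/measurable_EFinP/measurable_funTS/measurable_funM.
- by move=> r _; rewrite lee_fin mulr_ge0 ?powR_ge0.
apply: eq_integral => r; rewrite inE/= in_itv/= andbT => r0.
rewrite (eq_integral (fun=> (phin r * r `^ (Q - 1))%:E)); last first.
  by move=> y; rewrite inE/= => y1; rewrite (qn_dil qnP)// y1 mulr1.
rewrite integral_cst; last exact: measurable_quasi_sphere.
by rewrite muleC.
Qed.

(** The identity holds in [0, +oo], by monotone convergence along the quasi-balls,
so that finiteness of the one-dimensional integral yields integrability on the
group. *)
Lemma radial_integral :
  (\int[mu]_x (phi (qn x))%:E = sigma (quasi_sphere qn) *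
     \int[leb]_(r in `]0%R, +oo[) (phi r * r `^ (Q - 1))%:E)%E.
Proof.
have mqn := measurable_quasi_norm qnP.
have mphiQ : measurable_fun setT (fun r => phi r * r `^ (Q - 1)).
  by apply: measurable_funM => //; exact: measurable_powR.
have mle (n : nat) : measurable [set r : R | r <= n%:R].
  rewrite (_ : [set _ | _] = `]-oo, n%:R]%classic); first exact: measurable_itv.
  by apply/seteqP; split=> r /=; rewrite in_itv.
have cvgL : (\int[mu]_(x in [set x | (qn x <= n%:R)%R]) (phi (qn x))%:E)%E @[n --> \oo]
    --> (\int[mu]_x (phi (qn x))%:E)%E.
  rewrite -[X in integral _ X](_ : \bigcup_n [set x | qn x <= n%:R] = setT); last first.
    apply/seteqP; split=> // x _; exists (Num.truncn (qn x)).+1 => //=.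
    exact/ltW/truncnS_gt.
  apply: ge0_nondecreasing_set_cvg_integral => [m n mn|n|n|n x _].
  - by rewrite subsetEset => x /= /le_trans; apply; rewrite ler_nat.
  - exact: (measurable_quasi_ball qnP).
  - by apply/measurable_EFinP/measurable_funTS/measurableT_comp.
  - by rewrite lee_fin.
have cvgR : (\int[leb]_(r in `]0%R, +oo[%classic `&` [set r | (r <= n%:R)%R])
      (phi r * r `^ (Q - 1))%R%:E)%E @[n --> \oo]
    --> (\int[leb]_(r in `]0%R, +oo[) (phi r * r `^ (Q - 1))%R%:E)%E.
  rewrite -[X in _ --> integral _ X _](_ : \bigcup_n
      (`]0%R, +oo[%classic `&` [set r | r <= n%:R]) = `]0%R, +oo[%classic); last first.
    apply/seteqP; split=> [r [n _ []]//|r r0]; exists (Num.truncn r).+1 => //; split => //=.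
    exact/ltW/truncnS_gt.
  apply: (@ge0_nondecreasing_set_cvg_integral _ (measurableTypeR R)) => [m n mn|n|n|n r _].
  - by rewrite subsetEset => r /= [? /le_trans r_le]; split => //; apply: r_le; rewrite ler_nat.
  - by apply: measurableI => //; exact: mle.
  - exact/measurable_EFinP/measurable_funTS.
  - by rewrite lee_fin mulr_ge0 ?powR_ge0.
rewrite -(cvg_lim _ cvgL)//; apply/cvg_lim => //.
under eq_fun do rewrite radial_integral_ball.
by apply: cvgeZl => //; rewrite quasi_sphere_fin.
Qed.

End radial_integral.

(** * The Gibbs inequality *)

Section gibbs.
Context d {T : measurableType d} {R : realType}.
Variable mu : {measure set T -> \bar R}.
Variables (f V : T -> R) (z : R).
Hypothesis f_ge0 : forall x, 0 <= f x.
Hypothesis f_int : mu.-integrable setT (EFin \o f).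
Hypothesis f1 : (\int[mu]_x (f x)%:E = 1)%E.
Hypothesis mV : measurable_fun setT V.
Hypothesis expV : (\int[mu]_x (expR (- V x))%:E = z%:E)%E.
Hypothesis z_gt0 : 0 < z.
Hypothesis fV_int : mu.-integrable setT (fun x => (f x * V x)%:E).

Let mf : measurable_fun setT f.
Proof. by apply/measurable_EFinP; exact: measurable_int f_int. Qed.

Let entropy_term x : R := f x * ln (f x)^-1.
Let majorant x : R := f x * V x + ln z * f x + (z^-1 * expR (- V x) - f x).

(** With y = exp (- v) / (z a) this is a log y <= a (y - 1). The last summand
z^-1 exp (- v) - a makes the bound hold at a = 0 as well, and it integrates to 0
when a and z^-1 exp (- v) are densities. *)
Lemma gibbs_pointwise (a v : R) : 0 <= a ->
  a * ln a^-1 <= a * v + ln z * a + (z^-1 * expR (- v) - a).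
Proof.
rewrite le_eqVlt => /predU1P[<-|a0].
  by rewrite !(mul0r, mulr0, add0r, subr0) mulr_ge0 ?expR_ge0// invr_ge0 ltW.
have y0 : 0 < z^-1 * expR (- v) / a by rewrite !mulr_gt0 ?invr_gt0 ?expR_gt0.
have : ln (z^-1 * expR (- v) / a) <= z^-1 * expR (- v) / a - 1.
  have yN1 : -1 < z^-1 * expR (- v) / a - 1 by lra.
  by have := le_ln1Dx yN1; rewrite addrC subrK.
rewrite lnM ?posrE ?invr_gt0 ?mulr_gt0 ?invr_gt0 ?expR_gt0//.
rewrite lnM ?posrE ?invr_gt0 ?expR_gt0// expRK !lnV ?posrE// => h.
have -> : z^-1 * expR (- v) - a = a * (z^-1 * expR (- v) / a - 1).
  by field; rewrite !gt_eqF.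
rewrite [ln z * a]mulrC -!mulrDr ler_pM2l//; lra.
Qed.

Let expV_int : mu.-integrable setT (fun x => (expR (- V x))%:E).
Proof.
apply/integrableP; split.
  by apply/measurable_EFinP; apply: measurableT_comp => //; exact: measurable_funN.
under eq_integral do rewrite gee0_abs ?lee_fin ?expR_ge0//.
by rewrite expV ltry.
Qed.

Let majorant_int : mu.-integrable setT (EFin \o majorant).
Proof.
apply: (@integrableD _ _ _ _ _ measurableT
   (fun x => (f x * V x + ln z * f x)%:E) (fun x => (z^-1 * expR (- V x) - f x)%:E)).
- apply: (@integrableD _ _ _ _ _ measurableT
   (fun x => (f x * V x)%:E) (fun x => (ln z * f x)%:E)) => //.
  exact: (@integrableZl _ _ _ _ _ measurableT (ln z) (EFin \o f)).
- apply: (@integrableB _ _ _ _ _ measurableT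
   (fun x => (z^-1 * expR (- V x))%:E) (fun x => (f x)%:E)) => //.
  exact: (@integrableZl _ _ _ _ _ measurableT z^-1 (fun x => (expR (- V x))%:E)).
Qed.

Let integral_majorant :
  (\int[mu]_x (majorant x)%:E = \int[mu]_x (f x * V x)%:E + (ln z)%:E)%E.
Proof.
have zf_int := @integrableZl _ _ _ _ _ measurableT (ln z) _ f_int.
have zV_int := @integrableZl _ _ _ _ _ measurableT z^-1 _ expV_int.
transitivity (\int[mu]_x (((f x * V x)%:E + (ln z)%:E * (f x)%:E) +
    ((z^-1)%:E * (expR (- V x))%:E - (f x)%:E)))%E; first exact: eq_integral.
rewrite integralD//; [|exact: integrableD|exact: integrableB].
rewrite integralD// integralB// !integralZl// f1 expV.
by rewrite mule1 -EFinM mulVf ?gt_eqF// subee// adde0.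
Qed.

Let m_entropy_term : measurable_fun setT entropy_term.
Proof.
apply: measurable_funM => //.
rewrite (_ : (fun x => _) = (fun x => - ln (f x))).
  by apply: measurableT_comp => //; exact: measurableT_comp.
apply/funext => x; have [|f0] := ltP 0 (f x); first exact: lnV.
have -> : f x = 0 by apply/eqP; rewrite eq_le f0 f_ge0.
by rewrite invr0 ln0// oppr0.
Qed.

Let entropy_term_le x : entropy_term x <= majorant x.
Proof. exact: gibbs_pointwise. Qed.

Lemma gibbs_positive_part :
  (\int[mu]_x (EFin \o (fun x => f x * ln (f x)^-1)%R)^\+ x < +oo)%E.
Proof.
apply: (@le_lt_trans _ _ (\int[mu]_x (EFin \o majorant)^\+ x)%E).
  apply: ge0_le_integral => //.
  - by apply: measurable_funepos; apply/measurable_EFinP.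
  - by apply: measurable_funepos; exact: (measurable_int _ majorant_int).
  - by move=> x _; apply: (funepos_le (D := setT)) => [y _|]; [exact: entropy_term_le|rewrite inE].
by rewrite ltey_eq integrable_pos_fin_num.
Qed.

(** The entropy term may fail to be integrable, but only through its negative part;
comparing positive and negative parts separately covers the value -oo. *)
Lemma gibbs_inequality :
  (\int[mu]_x (f x * ln (f x)^-1)%:E <= \int[mu]_x (f x * V x)%:E + (ln z)%:E)%E.
Proof.
rewrite -integral_majorant integralE [leRHS]integralE leeB//.
- apply: ge0_le_integral => //.
  + by apply: measurable_funepos; apply/measurable_EFinP.
  + by apply: measurable_funepos; exact: (measurable_int _ majorant_int).
  + by move=> x _; apply: (funepos_le (D := setT)) => [y _|]; [exact: entropy_term_le|rewrite inE].
- apply: ge0_le_integral => //.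
  + by apply: measurable_funeneg; exact: (measurable_int _ majorant_int).
  + by apply: measurable_funeneg; apply/measurable_EFinP.
  + by move=> x _; apply: (funeneg_le (D := setT)) => [y _|]; [exact: entropy_term_le|rewrite inE].
Qed.

End gibbs.

(** * Integrability in the weighted space *)

Section L1norm.
Context {R : realType} {N : nat}.
Local Notation mu := (lebesgue_rV R N).
Implicit Types (u w : 'rV[R]_N -> R).

Lemma L1normE u : mu.-integrable setT (EFin \o u) ->
  (\int[mu]_x `|u x|%:E = (L1norm u)%:E)%E.
Proof.
by move=> /integrable_abse/integrable_fin_num ui; rewrite /L1norm Lnorm1 fineK// ui.
Qed.

Lemma L1norm_gt0 u : mu.-integrable setT (EFin \o u) -> ~ ae_zero u ->
  0 < L1norm u.
Proof.
move=> ui u0; have muE := measurable_int _ ui.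
rewrite lt_neqAle; apply/andP; split; last first.
  by rewrite -lee_fin -L1normE// integral_ge0// => x _; rewrite lee_fin.
apply/eqP => L0; apply: u0.
have : (\int[mu]_x `|(EFin \o u) x| = 0)%E.
  by rewrite [LHS](L1normE ui) -L0.
move=> /(ae_eq_integral_abs mu measurableT muE).
by apply: filterS => x /= /(_ I) [].
Qed.

End L1norm.

Section weighted_space.
Context {R : realType} {N : nat} {G : homogeneous_group R N}.
Local Notation mu := (lebesgue_rV R N).
Hypothesis N_gt0 : (0 < N)%N.
Variable qn : 'rV[R]_N -> R.
Hypothesis qnP : quasi_norm G qn.
Variable alpha : R.
Hypothesis alpha_gt0 : 0 < alpha.
Implicit Types (u : 'rV[R]_N -> R).

Lemma measurable_qn_powR : measurable_fun setT (fun x => qn x `^ alpha).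
Proof.
apply: (measurableT_comp (measurable_powR alpha)).
exact: (measurable_quasi_norm qnP).
Qed.

Lemma japanese_ge1 x : 1 <= japanese qn x.
Proof. by rewrite -[leLHS]sqrtr1 ler_wsqrtr// lerDl sqr_ge0. Qed.

Lemma japanese_ge_qn x : qn x <= japanese qn x.
Proof.
rewrite -[leLHS]ger0_norm ?(qn_ge0 qnP)// -sqrtr_sqr ler_wsqrtr// lerDr.
exact: ler01.
Qed.

(** Up to a constant the weight is 1 + |x|^alpha, so that membership in the weighted
space amounts to integrability of u and of |x|^alpha u. *)
Lemma japanese_powR_le x :
  japanese qn x `^ alpha <= 2 `^ alpha * (1 + qn x `^ alpha).
Proof.
have q0 := qn_ge0 qnP x.
have le2 : japanese qn x <= 2 * Num.max 1 (qn x).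
  rewrite -[leRHS]ger0_norm ?mulr_ge0 ?le_max ?ler01// -sqrtr_sqr ler_wsqrtr//.
  have [h|/ltW h] := leP (qn x) 1; nra.
have m0 : 0 <= Num.max 1 (qn x) by rewrite le_max ler01.
apply: (@le_trans _ _ ((2 * Num.max 1 (qn x)) `^ alpha)).
  rewrite ge0_ler_powR ?nnegrE ?(ltW alpha_gt0) ?sqrtr_ge0//.
  exact: mulr_ge0.
rewrite powRM// ler_pM2l ?powR_gt0//.
have [h|/ltW h] := leP (qn x) 1; first by rewrite powR1 lerDl powR_ge0.
by rewrite lerDr.
Qed.

Lemma measurable_japanese_powR :
  measurable_fun setT (fun x => japanese qn x `^ alpha).
Proof.
apply: (measurableT_comp (measurable_powR alpha)).
apply: (measurableT_comp (continuous_measurable_fun (@sqrt_continuous R))).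
apply: measurable_funD => //; apply: measurable_funX.
exact: (measurable_quasi_norm qnP).
Qed.

Lemma L1_weighted_integrable u : L1_weighted qn alpha u ->
  mu.-integrable setT (EFin \o u).
Proof.
move=> [m_u _ ju]; apply: le_integrable ju => //; first exact/measurable_EFinP.
move=> x _; rewrite /= lee_fin normrM ler_peMl// (@le_trans _ _ 1)//.
rewrite ger0_norm ?powR_ge0// -[leLHS](powRr0 (japanese qn x)).
by rewrite ler_powR ?japanese_ge1 ?ltW.
Qed.

Lemma L1_weighted_moment_integrable u : L1_weighted qn alpha u ->
  mu.-integrable setT (EFin \o (fun x => qn x `^ alpha * u x)).
Proof.
move=> [m_u _ ju]; apply: le_integrable ju => //.
  by apply/measurable_EFinP; apply: measurable_funM => //; exact: measurable_qn_powR.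
move=> x _; rewrite /= lee_fin !normrM ler_wpM2r// !ger0_norm ?powR_ge0//.
rewrite ge0_ler_powR ?nnegrE ?(ltW alpha_gt0) ?(qn_ge0 qnP) ?sqrtr_ge0//.
exact: japanese_ge_qn.
Qed.

(** The weight |x|^alpha vanishes only at the origin, which is a null set. *)
Lemma moment_not_ae_zero u : ~ ae_zero u -> ~ ae_zero (fun x => qn x `^ alpha * u x).
Proof.
apply: contra_not => qu0.
have : {ae mu, forall x, x != 0}.
  exists [set 0]; split; first exact: measurable_rV_origin.
    exact: lebesgue_rV_origin.
  by move=> x /= /negP; rewrite negbK => /eqP.
apply: filterS2 qu0 => x /eqP + x0.
by rewrite mulf_eq0 gt_eqF ?powR_gt0 ?(quasi_norm_gt0 qnP)// => /eqP.
Qed.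

End weighted_space.

(** * The entropy inequality and its extremals *)

Section entropy_inequality.
Context {R : realType} {N : nat} {G : homogeneous_group R N}.
Local Notation mu := (lebesgue_rV R N).
Local Notation Q := (hom_dim G).
Hypothesis N_gt0 : (0 < N)%N.
Variable qn : 'rV[R]_N -> R.
Hypothesis qnP : quasi_norm G qn.
Variable sigma : {measure set 'rV[R]_N -> \bar R}.
Hypothesis sigmaP : polar_measure G qn sigma.
Variable alpha : R.
Hypothesis alpha_gt0 : 0 < alpha.
Implicit Types (u : 'rV[R]_N -> R) (l : R).

Let Q_gt0 : 0 < Q := hom_dim_gt0 N_gt0.
Let Z := fine (sigma (quasi_sphere qn)) * Gamma (Q / alpha) / alpha.
Definition sharp_constant := Z `^ (alpha / Q).

Lemma measurable_extremal l : measurable_fun setT (extremal alpha l qn).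
Proof.
apply: (measurableT_comp (@measurable_expR R)); apply: measurable_funN.
by apply: measurable_funM => //; exact: (measurable_qn_powR qnP).
Qed.

Lemma integral_extremal_polar l : 0 < l ->
  (\int[mu]_x (extremal alpha l qn x)%:E = (Z * l `^ (- (Q / alpha)))%:E)%E.
Proof.
move=> l0.
rewrite (radial_integral N_gt0 qnP sigmaP (M := 1)
  (phi := fun r => expR (- (l * r `^ alpha)))); last 3 first.
- apply: (measurableT_comp (@measurable_expR R)); apply: measurable_funN.
  by apply: measurable_funM => //; exact: measurable_powR.
- by move=> r; exact: expR_ge0.
- by move=> r; rewrite -expR0 ler_expR oppr_le0 mulr_ge0 ?powR_ge0// ltW.
rewrite integral_expRN_powR// (quasi_sphere_fin N_gt0 qnP sigmaP) -EFinM /Z.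
by congr EFin; ring.
Qed.

Lemma extremal_not_ae_zero l : ~ ae_zero (extremal alpha l qn).
Proof.
move=> [A [mA A0 sA]].
have AT : A = setT.
  apply/seteqP; split=> // x _; apply: sA => /= /eqP.
  by rewrite gt_eqF ?expR_gt0.
by have := lebesgue_rV_gt0 R N; rewrite -AT A0 ltxx.
Qed.

Lemma integrable_extremal l : 0 < l ->
  mu.-integrable setT (EFin \o extremal alpha l qn).
Proof.
move=> l0; apply/integrableP; split.
  by apply/measurable_EFinP; exact: measurable_extremal.
under eq_integral do rewrite /= ger0_norm ?expR_ge0//.
by rewrite integral_extremal_polar// ltry.
Qed.

Lemma L1norm_extremal_polar l : 0 < l ->
  L1norm (extremal alpha l qn) = Z * l `^ (- (Q / alpha)).
Proof.
move=> l0; apply: EFin_inj; rewrite -L1normE ?integrable_extremal//.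
rewrite -integral_extremal_polar//; apply: eq_integral => x _.
by rewrite ger0_norm ?expR_ge0.
Qed.

(** Z is the mass of exp (- |x|^alpha), hence positive; in particular neither the
sphere nor the Gamma value can vanish. *)
Let Z_gt0 : 0 < Z.
Proof.
have := L1norm_gt0 (integrable_extremal ltr01) (@extremal_not_ae_zero 1).
by rewrite L1norm_extremal_polar// powR1 mulr1.
Qed.

Lemma sharp_constant_gt0 : 0 < sharp_constant.
Proof. exact: powR_gt0. Qed.

Lemma sharp_constantE : sharp_constant `^ (Q / alpha) = Z.
Proof.
rewrite -powRrM mulrA divfK ?divff ?powRr1 ?gt_eqF//; exact: ltW.
Qed.

Local Notation A := sharp_constant.

Lemma integral_extremal l : 0 < l ->
  (\int[mu]_x (extremal alpha l qn x)%:E = ((A / l) `^ (Q / alpha))%:E)%E.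
Proof.
move=> l0; rewrite integral_extremal_polar// -sharp_constantE powRM//.
- by rewrite -[l^-1]powR_inv1 ?(ltW l0)// -powRrM mulN1r.
- exact/ltW/sharp_constant_gt0.
- by rewrite invr_ge0 ltW.
Qed.

Lemma L1norm_extremal : L1norm (extremal alpha A qn) = 1.
Proof.
have A0 := sharp_constant_gt0.
rewrite L1norm_extremal_polar// powRN sharp_constantE divff// gt_eqF//.
Qed.

(** Half of the exponential absorbs the power, by 1 + y <= exp y with
y = (l / 2) |x|^alpha. *)
Lemma moment_extremal_le l x : 0 < l ->
  qn x `^ alpha * extremal alpha l qn x <= 2 / l * extremal alpha (l / 2) qn x.
Proof.
move=> l0; rewrite /extremal; set q := qn x `^ alpha.
have q0 : 0 <= q by exact: powR_ge0.
have -> : - (l * q) = - (l / 2 * q) + - (l / 2 * q) by field.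
rewrite expRD mulrA ler_pM2r ?expR_gt0// expRN ler_pdivrMr ?expR_gt0//.
rewrite -ler_pdivrMl ?divr_gt0// invf_div.
by apply: le_trans (expR_ge1Dx _); rewrite lerDr.
Qed.

(** By [moment_extremal_le] the weight costs only half of the exponential rate. *)
Lemma extremal_L1_weighted l : 0 < l -> L1_weighted qn alpha (extremal alpha l qn).
Proof.
move=> l0; have l20 : 0 < l / 2 by rewrite divr_gt0.
split; first exact: measurable_extremal.
  move=> K cK; apply: (integrableS measurableT) (integrable_extremal l0) => //.
  have cC : closed K by apply: compact_closed => //; exact: norm_hausdorff.
  rewrite -(setCK K); apply: measurableC; rewrite measurable_rVE.
  by apply: sub_sigma_algebra; exact: closed_openC.
have E1 := @integrableZl _ _ _ _ _ measurableT (2 `^ alpha) _ (integrable_extremal l0).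
have E2 := @integrableZl _ _ _ _ _ measurableT (2 `^ alpha * (2 / l)) _ (integrable_extremal l20).
apply: le_integrable (integrableD _ E1 E2) => //.
  apply/measurable_EFinP; apply: measurable_funM; last exact: measurable_extremal.
  exact: (measurable_japanese_powR qnP).
move=> x _; rewrite /= lee_fin.
have e0 k : 0 <= extremal alpha k qn x by exact: expR_ge0.
rewrite !ger0_norm; last 2 first.
- have lV : 0 <= l^-1 by rewrite invr_ge0 ltW.
  by apply: addr_ge0; rewrite !mulr_ge0 ?powR_ge0.
- by apply: mulr_ge0 => //; exact: powR_ge0.
apply: (le_trans (ler_wpM2r (e0 l) (japanese_powR_le qnP alpha_gt0 x))).
rewrite -!mulrA -mulrDr ler_pM2l ?powR_gt0// mulrDl mul1r lerD2l mulrA.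
exact: moment_extremal_le.
Qed.

(** Gibbs' inequality against exp (- l |x|^alpha), at the rate l = Q / (alpha m)
that minimizes l m + (Q / alpha) log (A / l). *)
Lemma entropy_le_bound u : L1_weighted qn alpha u -> ~ ae_zero u ->
  entropy_well_defined u /\ (entropy u <= (entropy_bound Q alpha A qn u)%:E)%E.
Proof.
move=> uL u0; have A0 := sharp_constant_gt0.
have u_int := L1_weighted_integrable alpha_gt0 uL.
have qu_int := L1_weighted_moment_integrable qnP alpha_gt0 uL.
have n0 := L1norm_gt0 u_int u0.
have qn0 := L1norm_gt0 qu_int (moment_not_ae_zero N_gt0 qnP (alpha := alpha) u0).
set n := L1norm u in n0; set k := L1norm _ in qn0.
have f_int : mu.-integrable setT (EFin \o (fun x => `|u x| / n)).
  have := @integrableZl _ _ _ _ _ measurableT n^-1 _ (integrable_abse u_int).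
  by apply: eq_integrable => // x _; rewrite /= -EFinM mulrC.
have f1 : (\int[mu]_x (`|u x| / n)%R%:E = 1)%E.
  under eq_integral do rewrite mulrC EFinM.
  rewrite ge0_integralZl//; last 2 first.
  - by apply/measurable_EFinP/measurableT_comp => //; case: uL.
  - by rewrite lee_fin invr_ge0 ltW.
  by rewrite L1normE// -EFinM mulVf// gt_eqF.
(* k / n is the mean of |x|^alpha under the density |u| / n. *)
pose l := Q / (alpha * (k / n)).
have l0 : 0 < l by rewrite !divr_gt0// mulr_gt0// divr_gt0.
have mV : measurable_fun setT (fun x => l * qn x `^ alpha).
  by apply: measurable_funM => //; exact: (measurable_qn_powR qnP).
have fV_int : mu.-integrable setT (fun x => (`|u x| / n * (l * qn x `^ alpha))%:E).
  have := @integrableZl _ _ _ _ _ measurableT (l / n) _ (integrable_abse qu_int).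
  apply: eq_integrable => // x _; rewrite /= -EFinM normrM.
  by rewrite ger0_norm ?powR_ge0//; congr EFin; ring.
have fV : (\int[mu]_x (`|u x| / n * (l * qn x `^ alpha))%R%:E = (Q / alpha)%:E)%E.
  rewrite (eq_integral (fun x => (l / n)%:E * `|qn x `^ alpha * u x|%:E)%E); last first.
    move=> x _; rewrite -EFinM normrM (ger0_norm (powR_ge0 _ _)).
    by congr EFin; ring.
  rewrite ge0_integralZl//; last 2 first.
  - apply/measurable_EFinP/measurableT_comp => //; apply/measurable_EFinP.
    exact: (measurable_int _ qu_int).
  - by rewrite lee_fin divr_ge0// ltW.
  rewrite L1normE// -EFinM /l -/k; congr EFin.
  by field; rewrite !gt_eqF.
have z0 : 0 < (A / l) `^ (Q / alpha) by rewrite powR_gt0// divr_gt0.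
have f_ge0 x : 0 <= `|u x| / n by rewrite divr_ge0// ltW.
have expV := integral_extremal l0.
split; first exact: (gibbs_positive_part f_ge0 f_int mV expV z0 fV_int).
apply: le_trans (gibbs_inequality f_ge0 f_int f1 mV expV z0 fV_int) _.
rewrite fV -EFinD lee_fin ln_powR /entropy_bound -/n -/k.
have -> : alpha * expR 1 * A / Q * (k / n) = expR 1 * (A / l).
  by rewrite /l; field; rewrite !gt_eqF.
rewrite [ln (expR _ * _)]lnM ?posrE ?expR_gt0 ?(divr_gt0 A0 l0)//.
by rewrite expRK mulrDr mulr1.
Qed.

(** Only one inequality is new: with x = alpha A m / Q, the bound is
(Q / alpha) (1 + log x) and the entropy is A m = (Q / alpha) x, so 1 + log x <= x
gives the converse of [entropy_le_bound]. *)
Lemma entropy_extremal : entropy (extremal alpha A qn) =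
  (entropy_bound Q alpha A qn (extremal alpha A qn))%:E.
Proof.
have A0 := sharp_constant_gt0.
have EL := extremal_L1_weighted A0.
have E0 := @extremal_not_ae_zero A.
have qE_int := L1_weighted_moment_integrable qnP alpha_gt0 EL.
have k0 := L1norm_gt0 qE_int (moment_not_ae_zero N_gt0 qnP (alpha := alpha) E0).
have [_ entle] := entropy_le_bound EL E0.
apply/eqP; rewrite eq_le entle/=.
rewrite /entropy /entropy_bound /entropy_density L1norm_extremal divr1.
set k := L1norm _ in k0 *.
have -> : (\int[mu]_x (`|extremal alpha A qn x| / 1 *
    ln (`|extremal alpha A qn x| / 1)^-1)%R%:E = (A * k)%:E)%E.
  rewrite EFinM -L1normE// -ge0_integralZl//; last 2 first.
  - apply/measurable_EFinP/measurableT_comp => //; apply/measurable_EFinP.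
    exact: (measurable_int _ qE_int).
  - by rewrite lee_fin ltW.
  apply: eq_integral => x _; rewrite -EFinM; congr EFin.
  rewrite divr1 !normrM !ger0_norm ?expR_ge0 ?powR_ge0// -expRN opprK expRK.
  by rewrite mulrCA mulrC; ring.
rewrite lee_fin.
have x0 : 0 < alpha * A / Q * k by rewrite !mulr_gt0 ?invr_gt0.
have -> : alpha * expR 1 * A / Q * k = expR 1 * (alpha * A / Q * k) by ring.
rewrite lnM ?posrE ?expR_gt0// expRK.
have -> : A * k = Q / alpha * (alpha * A / Q * k).
  by field; rewrite !gt_eqF.
rewrite ler_pM2l ?divr_gt0//.
have := @le_ln1Dx _ (alpha * A / Q * k - 1).
rewrite addrCA subrr addr0; lra.
Qed.

Lemma entropy_bound_lt u (B : R) : 0 < B -> B < A ->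
  0 < L1norm u -> 0 < L1norm (fun x => qn x `^ alpha * u x) ->
  entropy_bound Q alpha B qn u < entropy_bound Q alpha A qn u.
Proof.
move=> B0 BA n0 k0; have A0 := sharp_constant_gt0.
rewrite /entropy_bound ltr_pM2l ?divr_gt0// ltr_ln ?posrE; last 2 first.
- by rewrite !mulr_gt0 ?divr_gt0 ?invr_gt0 ?expR_gt0.
- by rewrite !mulr_gt0 ?divr_gt0 ?invr_gt0 ?expR_gt0.
by rewrite ltr_pM2r ?divr_gt0// ltr_pM2r ?invr_gt0// ltr_pM2l// mulr_gt0 ?expR_gt0.
Qed.

End entropy_inequality.

Theorem theorem3p1 (R : realType) (N : nat) (N_gt0 : (0 < N)%N)
    (G : homogeneous_group R N)
    (qn : 'rV[R]_N -> R) (qnP : quasi_norm G qn)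
    (sigma : {measure set 'rV[R]_N -> \bar R})
    (sigmaP : polar_measure G qn sigma)
    (alpha : R) (alpha_gt0 : 0 < alpha) :
  let Q := hom_dim G in
  let S := fine (sigma (quasi_sphere qn)) in
  exists A : R,
    (0 < A /\ A `^ (Q / alpha) = S * Gamma (Q / alpha) / alpha) /\
    [/\ forall u : 'rV[R]_N -> R, L1_weighted qn alpha u -> ~ ae_zero u ->
          entropy_well_defined u /\
          (entropy u <= (entropy_bound Q alpha A qn u)%:E)%E,
        forall B : R, 0 < B -> B < A ->
          ~ (forall u : 'rV[R]_N -> R, L1_weighted qn alpha u -> ~ ae_zero u ->
               (entropy u <= (entropy_bound Q alpha B qn u)%:E)%E),
        L1_weighted qn alpha (extremal alpha A qn) /\
          ~ ae_zero (extremal alpha A qn) &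
        entropy (extremal alpha A qn) =
          (entropy_bound Q alpha A qn (extremal alpha A qn))%:E].
Proof.
move=> Q S; pose A := @sharp_constant R N G qn sigma alpha.
have A0 : 0 < A := sharp_constant_gt0 N_gt0 qnP sigmaP alpha_gt0.
have EL : L1_weighted qn alpha (extremal alpha A qn).
  exact: (extremal_L1_weighted N_gt0 qnP sigmaP).
have E0 := @extremal_not_ae_zero R N qn alpha A.
have eqE : entropy (extremal alpha A qn) =
    (entropy_bound Q alpha A qn (extremal alpha A qn))%:E.
  exact: (entropy_extremal N_gt0 qnP sigmaP).
exists A; split; first by split => //; exact: (sharp_constantE N_gt0 qnP sigmaP).
split=> // [u uL u0|B B0 BA bound_B].
  exact: (entropy_le_bound N_gt0 qnP sigmaP).
have := bound_B _ EL E0; rewrite eqE lee_fin; apply/negP; rewrite -ltNge.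
apply: (entropy_bound_lt N_gt0 qnP sigmaP) => //; apply: L1norm_gt0 => //.
- exact: L1_weighted_integrable EL.
- exact: (L1_weighted_moment_integrable qnP alpha_gt0 EL).
- exact: (moment_not_ae_zero N_gt0 qnP).
Qed.
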